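(* Any algorithm for maximizing a non-negative submodular function $f\colon2^{\mathcal N}\to\mathbb R_{\ge0}$ over the bases of a partition matroid that guarantees $(\alpha,\beta)$-bicriteria approximation for constants $\alpha\in(0,1]$ and $\beta\ge1$ must use an exponential number of value oracle queries.
   Context: $f$ is submodular if $f(S\cup\{u\})-f(S)\ge f(T\cup\{u\})-f(T)$ for all $S\subseteq T\subseteq\mathcal N$, $u\notin T$; $f$ is accessed only via a value oracle. A partition matroid is given by a partition of $\mathcal N$ into disjoint sets $\mathcal N_1,\dots,\mathcal N_\ell$ and integers $0\le r_i\le|\mathcal N_i|$; its bases are the sets $S$ with $|S\cap\mathcal N_i|=r_i$ for all $i$. The feasible sets are the bases; let $\mathcal P$ be the convex hull of their characteristic vectors and $OPT$ a base maximizing $f$. An $(\alpha,\beta)$-bicriteria approximation algorithm outputs a set $S$ with $\mathbb E[f(S)]\ge\alpha f(OPT)$ such that there exist $\mathbf y_1,\mathbf y_2\in\mathcal P$ with $\mathbf y_1\le\mathbf 1_S\le\beta\mathbf y_2$ coordinate-wise. *)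

(* Defs.v *)
From HB Require Import structures.
From mathcomp Require Import all_boot all_order all_algebra.
From mathcomp Require Import all_classical all_reals all_analysis.
Set Implicit Arguments. Unset Strict Implicit. Unset Printing Implicit Defensive.
Import Order.TTheory GRing.Theory Num.Theory.
Local Open Scope ring_scope.

Section Defs.
Variable R : realType.
Variable n : nat.
Local Notation U := ('I_n).

Definition submodular (f : {set U} -> R) : Prop :=
  forall (S T : {set U}) (u : U), S \subset T -> u \notin T ->
    f (u |: T) - f T <= f (u |: S) - f S.

Definition nonneg_fun (f : {set U} -> R) : Prop := forall S, 0 <= f S.

(* A partition matroid: block label of each element, and rank of each block.
   Block k is N_k = [set u | part u == k]; unused labels give empty blocks. *)
Definition block (part : U -> nat) (k : nat) : {set U} := [set u | part u == k].

Definition valid_pm (part : U -> nat) (r : nat -> nat) : Prop :=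
  forall k, (r k <= #|block part k|)%N.

Definition is_base (part : U -> nat) (r : nat -> nat) (S : {set U}) : Prop :=
  forall k, #|S :&: block part k| = r k.

Definition chi (S : {set U}) : U -> R := fun u => if u \in S then 1 else 0.

Definition in_base_polytope (part : U -> nat) (r : nat -> nat) (y : U -> R) : Prop :=
  exists lam : {set U} -> R,
    (forall B, 0 <= lam B) /\
    (forall B, lam B != 0 -> is_base part r B) /\
    \sum_(B : {set U}) lam B = 1 /\
    (forall u, y u = \sum_(B : {set U}) lam B * chi B u).

Definition bicriteria_feasible (part : U -> nat) (r : nat -> nat) (beta : R)
    (S : {set U}) : Prop :=
  exists y1 y2 : U -> R,
    in_base_polytope part r y1 /\ in_base_polytope part r y2 /\
    (forall u, y1 u <= chi S u) /\ (forall u, chi S u <= beta * y2 u).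

Definition is_opt (part : U -> nat) (r : nat -> nat) (f : {set U} -> R)
    (O : {set U}) : Prop :=
  is_base part r O /\ forall B, is_base part r B -> f B <= f O.

(* A (randomized) value-oracle algorithm: given the matroid (part, r), a random
   seed w and the history of (query, answer) pairs so far, it either issues a
   new query (inl Q) or stops with an output (inr S). *)
Definition history := seq ({set U} * R).
Definition action := ({set U} + {set U})%type.

Fixpoint run (strat : history -> action) (f : {set U} -> R) (q : nat)
    (h : history) : option {set U} :=
  match strat h with
  | inr T => Some T
  | inl Q => match q with
             | 0 => None
             | q'.+1 => run strat f q' (rcons h (Q, f Q))
             end
  end.

End Defs.

(* Main.v *)
(* A symmetry gap argument.  The ground set has two sides A and B, each made of
   m blocks of k elements; a base takes one element of each A-block and all but
   one element of each B-block.  A uniformly random h marks one element of every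
   block.  For a set S let X = S :&: A and Y = B :\: S, let a, c be their sizes,
   x, y their numbers of marked elements, and u = k x - a, v = k y - c.  Then
     a c + u v / (k - 1) = k / (k - 1) * ((k - 1) x y + (a - x) (c - y))
   is a directed cut function, hence submodular.  It is about k m^2 on the base
   made of the marked elements of A and the unmarked ones of B, whereas a
   feasible set with u = v = 0 has value at most beta m^2.  To hide h, the
   product u v is replaced by a function vanishing when |u| and |v| are below a
   small constant times m.  Its mixed second differences stay in [0, 1], and it
   grows so slowly (on a logarithmic scale) that its pure second differences are
   at most eps; small concave functions of a and of c compensate for these, so
   submodularity survives.  By a Chernoff bound a fixed set is balanced for all
   but an exponentially small fraction of the h, so an algorithm with few queries
   runs as if u v were absent and, for most h, outputs a set of small value. *)
Require Import Defs.
From HB Require Import structures.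
From mathcomp Require Import all_boot all_order all_algebra.
From mathcomp Require Import all_classical all_reals all_analysis.
From mathcomp Require Import measurable_realfun ring lra zify.
Set Implicit Arguments. Unset Strict Implicit. Unset Printing Implicit Defensive.
Import Order.TTheory GRing.Theory Num.Theory.
Local Open Scope ring_scope.

(** * A product flattened near the origin *)

Section Lattice.
Variable R : realType.

Lemma mean_slope (g : int -> R) (lo hi : R) :
  (forall z, lo <= g (z + 1) - g z <= hi) ->
  forall s z, exists2 d, lo <= d <= hi & g (z + s) - g z = s%:~R * d.
Proof.
move=> gP.
have lohi : lo <= hi by have /andP[] := gP 0; exact: le_trans.
have natP (s : nat) z :
    s%:R * lo <= g (z + s%:Z) - g z <= s%:R * hi.
  elim: s => [|s IHs]; first by rewrite addr0 subrr !mul0r lexx.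
  have /andP[l1 l2] := gP (z + s%:Z).
  move/andP: IHs => [IH1 IH2].
  have -> : z + s.+1%:Z = z + s%:Z + 1 by lia.
  rewrite -natr1 !mulrDl !mul1r; lra.
have natE (s : nat) z :
    exists2 d, lo <= d <= hi & g (z + s%:Z) - g z = s%:R * d.
  case: s => [|s]; first by exists lo; rewrite ?lexx // addr0 subrr mul0r.
  have s0 : (0 : R) < s.+1%:R by rewrite ltr0n.
  exists ((g (z + s.+1%:Z) - g z) / s.+1%:R).
    by rewrite ler_pdivlMr // ler_pdivrMr // ![_ * s.+1%:R]mulrC natP.
  by rewrite mulrC divfK // gt_eqF.
move=> [s|s] z; first exact: natE.
have [d dP dE] := natE s.+1 (z + Negz s).
exists d => //; rewrite NegzE mulrNz mulNr -dE opprB.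
by congr (g _ - g _); lia.
Qed.

Lemma mean_slope2 (F : int -> int -> R) (lo hi : R) :
  (forall x y, lo <= F (x + 1) (y + 1) - F (x + 1) y - F x (y + 1) + F x y
               <= hi) ->
  forall s t x y, exists2 d, lo <= d <= hi &
    F (x + s) (y + t) - F (x + s) y - F x (y + t) + F x y
    = s%:~R * t%:~R * d.
Proof.
move=> FP s t x y.
have lohi : lo <= hi by have /andP[] := FP 0 0; exact: le_trans.
have [->|s0] := eqVneq s 0.
  by exists lo; rewrite ?lexx // addr0 !mul0r; ring.
have sR0 : s%:~R != 0 :> R by rewrite intr_eq0.
pose g z := (F (x + s) z - F x z) / s%:~R.
have gP z : lo <= g (z + 1) - g z <= hi.
  have hP w : lo <= (F (w + 1) (z + 1) - F (w + 1) z)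
                    - (F w (z + 1) - F w z) <= hi.
    by have := FP w z; rewrite opprB addrA addrAC; congr (_ <= _ <= _); ring.
  have [d dP dE] := @mean_slope (fun w => F w (z + 1) - F w z) lo hi hP s x.
  suff -> : g (z + 1) - g z = d by [].
  by apply: (mulfI sR0); rewrite -dE /g; field.
have [d dP dE] := mean_slope gP t y.
by exists d => //; rewrite -mulrA -dE /g; field.
Qed.

(* [Negz n] is [- n.+1], so the unit interval from [z] to [z + 1] has the
   same index as its mirror image. *)
Definition step_index (z : int) : nat :=
  match z with Posz n => n | Negz n => n end.

Definition isum (F : nat -> R) (z : int) : R :=
  match z with
  | Posz n => \sum_(i < n) F i
  | Negz n => - \sum_(i < n.+1) F i
  end.

Lemma isumS F z : isum F (z + 1) - isum F z = F (step_index z).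
Proof.
case: z => [n|[|n]].
- have -> : Posz n + 1 = Posz n.+1 by lia.
  by rewrite /= big_ord_recr /=; ring.
- have -> : Negz 0 + 1 = 0 by lia.
  by rewrite /= big_ord0 big_ord1 opprK add0r.
- have -> : Negz n.+1 + 1 = Negz n by lia.
  by rewrite /= [X in _ - - X]big_ord_recr /=; ring.
Qed.

Lemma isumB F G z : isum F z - isum G z = isum (fun i => F i - G i) z.
Proof. by case: z => n /=; rewrite sumrB // -opprB; ring. Qed.

Lemma eq_isum F G z : (forall i, (i < `|z|)%N -> F i = G i) ->
  isum F z = isum G z.
Proof.
case: z => n FG /=; last congr (- _);
  by apply: eq_bigr => i _; apply: FG => /=.
Qed.

Lemma isum_norm_le F z : `|isum F z| <= \sum_(i < `|z|%N) `|F i|.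
Proof. by case: z => n /=; rewrite ?normrN; apply: ler_norm_sum. Qed.

Lemma isum0 F z : (forall i, (i < `|z|)%N -> F i = 0) -> isum F z = 0.
Proof.
move=> F0; apply/eqP; rewrite -normr_le0; apply: le_trans (isum_norm_le _ _) _.
by rewrite big1 // => i _; rewrite F0 ?normr0.
Qed.

Section Hiding.
Variables (D : nat) (eps : R).
Hypothesis eps_ge0 : 0 <= eps.

Definition theta (x : nat) : R :=
  Num.min 1 (eps * \sum_(D <= i < x) i.+1%:R^-1).

Lemma harmonic_ge0 a b : 0 <= \sum_(a <= i < b) (i.+1%:R^-1 : R).
Proof. by apply: sumr_ge0 => i _; rewrite invr_ge0. Qed.

Lemma theta_ge0 x : 0 <= theta x.
Proof. by rewrite le_min ler01 mulr_ge0 // harmonic_ge0. Qed.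

Lemma theta_le1 x : theta x <= 1.
Proof. by rewrite ge_min lexx. Qed.

Lemma theta_small x : (x <= D)%N -> theta x = 0.
Proof.
by move=> xD; rewrite /theta big_geq // mulr0; apply/min_idPr/ler01.
Qed.

Lemma theta_step x : 0 <= theta x.+1 - theta x <= eps / x.+1%:R.
Proof.
have [xD|Dx] := ltnP x D.
  rewrite !theta_small ?subrr ?lexx //= ?divr_ge0 //; exact: ltnW.
have e0 : 0 <= eps / x.+1%:R by rewrite divr_ge0.
rewrite /theta big_nat_recr //= mulrDr.
set a := eps * \sum_(_ <= _ < _) _.
by rewrite /Num.min; case: ifP; case: ifP; move: e0; set b := eps / _; lra.
Qed.

Lemma theta_mono x y : (x <= y)%N -> theta x <= theta y.
Proof.
elim: y => [|y IHy]; first by rewrite leqn0 => /eqP->.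
rewrite leq_eqVlt ltnS => /predU1P[->//|/IHy].
by have /andP[] := theta_step y; lra.
Qed.

Lemma harmonic_dyadic L : (0 < D)%N ->
  L%:R / 2 <= \sum_(D <= i < 2 ^ L * D) (i.+1%:R^-1 : R).
Proof.
move=> D0; elim: L => [|L IHL].
  by rewrite mul0r harmonic_ge0.
set N := (2 ^ L * D)%N in IHL *.
have N0 : (0 < N)%N by rewrite muln_gt0 expn_gt0 D0.
have DN : (D <= N)%N by rewrite leq_pmull // expn_gt0.
have -> : (2 ^ L.+1 * D = N + N)%N by rewrite expnS -mulnA mul2n addnn.
clearbody N.
rewrite (@big_cat_nat _ _ _ N) //=; last exact: leq_addr.
rewrite -natr1 mulrDl; apply: lerD => //.
have -> : 1 / 2 = \sum_(N <= i < N + N) ((N + N)%:R^-1 : R).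
  rewrite sumr_const_nat addnK natrD -mulr_natl.
  have : (N%:R : R) != 0 by rewrite pnatr_eq0 -lt0n.
  by move=> ?; field; lra.
apply: ler_sum_nat => i /andP[_ iN].
have NN : 0 < (N + N)%:R :> R by rewrite ltr0n addn_gt0 N0.
have i0 : 0 < i.+1%:R :> R by rewrite ltr0n.
by rewrite lef_pV2 // ler_nat.
Qed.

(* The mixed second differences are values of [theta]; since [theta] increases
   by at most [eps / x.+1] from [x] to [x.+1] and the maximum depends on [x] for
   only [x.+1] values of [y], the pure ones are at most [eps]. *)
Definition flatmul (u v : int) : R :=
  isum (fun x => isum (fun y => theta (maxn x y)) v) u.

Lemma flatmul_stepl u v :
  flatmul (u + 1) v - flatmul u v
  = isum (fun y => theta (maxn (step_index u) y)) v.
Proof. exact: isumS. Qed.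

Lemma isumC (F : nat -> nat -> R) u v :
  isum (fun x => isum (F x) v) u = isum (fun y => isum (F^~ y) u) v.
Proof.
case: u v => [m|m] [n|n] /=; rewrite ?sumrN ?opprK.
- by rewrite exchange_big.
- by rewrite exchange_big.
- by rewrite exchange_big.
- by rewrite exchange_big.
Qed.

Lemma hidC u v : flatmul u v = flatmul v u.
Proof.
rewrite /flatmul isumC; apply: eq_isum => x _; apply: eq_isum => y _.
by rewrite maxnC.
Qed.

Lemma flatmul_mixed u v :
  0 <= flatmul (u + 1) (v + 1) - flatmul (u + 1) v - flatmul u (v + 1) + flatmul u v <= 1.
Proof.
have -> : flatmul (u + 1) (v + 1) - flatmul (u + 1) v - flatmul u (v + 1) + flatmul u v
  = (flatmul (u + 1) (v + 1) - flatmul u (v + 1))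
    - (flatmul (u + 1) v - flatmul u v) by ring.
by rewrite !flatmul_stepl isumS theta_ge0 theta_le1.
Qed.

Lemma theta_max_step x n :
  \sum_(y < n) `|theta (maxn x.+1 y) - theta (maxn x y)| <= eps.
Proof.
have step y : `|theta (maxn x.+1 y) - theta (maxn x y)| <=
              if (y <= x)%N then eps / x.+1%:R else 0.
  case: leqP => yx.
    rewrite (maxn_idPl (leqW yx)).
    by have /andP[? ?] := theta_step x; rewrite ger0_norm.
  by rewrite (maxn_idPr yx) subrr normr0.
apply: (@le_trans _ _ (\sum_(y < n) if (y <= x)%N then eps / x.+1%:R else 0)).
  by apply: ler_sum => y _; exact: step.
rewrite -big_mkcond /= sumr_const.
have card_le : (#|[pred y : 'I_n | (y <= x)%N]| <= x.+1)%N.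
  rewrite -[leqRHS]card_ord.
  apply: (@leq_card_in _ _ (fun y : 'I_n => inord y)) => y z yx zx.
  by move/(congr1 val); rewrite /= !inordK // => /val_inj.
rewrite -[_ *+ _]mulr_natr -mulrA ler_piMr // mulrC ler_pdivrMr ?ltr0n // mul1r.
by rewrite ler_nat.
Qed.

Lemma flatmul_curv u v :
  - eps <= flatmul (u + 1 + 1) v - flatmul (u + 1) v - flatmul (u + 1) v
           + flatmul u v <= eps.
Proof.
have -> : flatmul (u + 1 + 1) v - flatmul (u + 1) v - flatmul (u + 1) v + flatmul u v
  = (flatmul (u + 1 + 1) v - flatmul (u + 1) v)
    - (flatmul (u + 1) v - flatmul u v) by ring.
rewrite !flatmul_stepl isumB -ler_norml; apply: le_trans (isum_norm_le _ _) _.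
case: u => [n|[|n]].
- have -> : Posz n + 1 = Posz n.+1 by lia.
  exact: theta_max_step.
- have -> : Negz 0 + 1 = 0 by lia.
  by rewrite big1 // => y _; rewrite subrr normr0.
- have -> : Negz n.+1 + 1 = Negz n by lia.
  by under eq_bigr do rewrite distrC; exact: theta_max_step.
Qed.

Lemma flatmul_mixed_step s t u v :
  flatmul (u + s) (v + t) - flatmul (u + s) v - flatmul u (v + t) + flatmul u v
  <= Num.max 0 (s * t)%:~R.
Proof.
have [d /andP[d0 d1] ->] := mean_slope2 flatmul_mixed s t u v.
rewrite intrM; case: (leP 0 (s%:~R * t%:~R : R)) => st.
  by rewrite ler_piMr.
by rewrite nmulr_rle0.
Qed.

Lemma flatmul_curv_step s t u v :
  `|flatmul (u + s + t) v - flatmul (u + s) v - flatmul (u + t) v + flatmul u v|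
  <= eps * `|s * t|%:~R.
Proof.
have FP x y : - eps <= flatmul (x + 1 + (y + 1)) v - flatmul (x + 1 + y) v
   - flatmul (x + (y + 1)) v + flatmul (x + y) v <= eps.
  have := flatmul_curv (x + y) v.
  have -> : x + y + 1 + 1 = x + 1 + (y + 1) by lia.
  have -> // : flatmul (x + (y + 1)) v = flatmul (x + 1 + y) v by congr flatmul; lia.
  by have -> : x + y + 1 = x + 1 + y by lia.
have [d dP] := mean_slope2 FP s t u 0.
rewrite !addr0 add0r => ->.
rewrite -ler_norml in dP.
by rewrite normrM -intrM intr_norm mulrC ler_wpM2r.
Qed.

Lemma flatmul_flat u v : (`|u| <= D)%N -> (`|v| <= D)%N -> flatmul u v = 0.
Proof.
move=> uD vD; apply: isum0 => x xu; apply: isum0 => y yv.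
by apply: theta_small; rewrite geq_max; lia.
Qed.

Lemma dsum_theta_bound m n :
  0 <= \sum_(x < m) \sum_(y < n) theta (maxn x y) <= m%:R * n%:R.
Proof.
apply/andP; split.
  by apply: sumr_ge0 => x _; apply: sumr_ge0 => y _; exact: theta_ge0.
have -> : m%:R * n%:R = \sum_(x < m) \sum_(y < n) (1 : R).
  under [RHS]eq_bigr do rewrite sumr_const card_ord.
  by rewrite sumr_const card_ord mulr_natl.
by apply: ler_sum => x _; apply: ler_sum => y _; exact: theta_le1.
Qed.

Lemma flatmul_lb u v : Num.min 0 (u * v)%:~R <= flatmul u v.
Proof.
rewrite ge_min intrM.
case: u v => [m|m] [n|n]; rewrite /flatmul /= ?sumrN ?opprK ?NegzE ?mulrNz.
- by have /andP[-> _] := dsum_theta_bound m n.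
- have /andP[_ h] := dsum_theta_bound m n.+1.
  by apply/orP; right; rewrite mulrN lerN2.
- have /andP[_ h] := dsum_theta_bound m.+1 n.
  by apply/orP; right; rewrite mulNr lerN2.
- by have /andP[-> _] := dsum_theta_bound m.+1 n.+1.
Qed.

Lemma flatmul_ub u v : flatmul u v <= `|u|%:~R * `|v|%:~R.
Proof.
case: u v => [m|m] [n|n]; rewrite /flatmul /= ?sumrN ?opprK ?NegzE ?normrN.
- by have /andP[_ h] := dsum_theta_bound m n.
- have /andP[h _] := dsum_theta_bound m n.+1.
  by apply: (@le_trans _ _ 0); rewrite ?oppr_le0 // mulr_ge0.
- have /andP[h _] := dsum_theta_bound m.+1 n.
  by apply: (@le_trans _ _ 0); rewrite ?oppr_le0 // mulr_ge0.
- by have /andP[_ h] := dsum_theta_bound m.+1 n.+1.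
Qed.

Lemma flatmul_large L (M : nat) : (0 < D)%N -> 1 <= eps * L%:R ->
  (2 * (2 ^ L * D) <= M)%N -> M%:R ^+ 2 / 4 <= flatmul M M.
Proof.
move=> D0 eL NM; set N := (2 ^ L * D)%N in NM.
have thN y : (N <= y)%N -> 1 / 2 <= theta y.
  move=> Ny; apply: le_trans (theta_mono Ny).
  rewrite le_min; apply/andP; split; first lra.
  have := ler_wpM2l eps_ge0 (harmonic_dyadic L D0); rewrite -/N; lra.
have inner (x : nat) : M%:R / 4 <= \sum_(y < M) theta (maxn x y).
  rewrite -(big_mkord xpredT (fun y => theta (maxn x y))).
  rewrite (@big_cat_nat _ _ _ N) //=; last by lia.
  apply: (@le_trans _ _ (\sum_(N <= y < M) (1 / 2))).
    rewrite sumr_const_nat -[leRHS]mulr_natr natrB; last by lia.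
    have : (2 * N)%:R <= (M%:R : R) by rewrite ler_nat.
    rewrite natrM; lra.
  rewrite -[leLHS]add0r; apply: lerD.
    by apply: sumr_ge0 => y _; exact: theta_ge0.
  apply: ler_sum_nat => y /andP[Ny _].
  by apply: thN; rewrite leq_max Ny orbT.
rewrite /flatmul /=.
have -> : M%:R ^+ 2 / 4 = \sum_(x < M) (M%:R / 4 : R).
  by rewrite sumr_const card_ord -[RHS]mulr_natr expr2; ring.
by apply: ler_sum => x _; exact: inner.
Qed.

End Hiding.
End Lattice.

(** * Submodular functions with a hidden set *)

Lemma submodular_local (R : realType) (n : nat) (f : {set 'I_n} -> R) :
  (forall (S : {set 'I_n}) e e', e \notin S -> e' \notin S -> e != e' ->
     f (e |: (e' |: S)) - f (e' |: S) <= f (e |: S) - f S) ->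
  submodular f.
Proof.
move=> loc S T u; have [p] := ubnP #|T :\: S|; elim: p S => // p IHp S.
rewrite ltnS => cardTS ST uT.
have [TS|/subsetPn[e eT eS]] := boolP (T \subset S).
  by have -> : T = S by apply/eqP; rewrite finset.eqEsubset TS ST.
have uS : u \notin S by apply: contra uT; exact: (fintype.subsetP ST).
have ue : u != e by apply: contraNneq uT => ->.
apply: le_trans (loc _ _ _ uS eS ue).
apply: IHp => //; last by rewrite finset.subUset finset.sub1set eT.
apply: leq_trans cardTS; apply: proper_card; apply/properP; split.
  by apply: finset.setDS; exact: finset.subsetUr.
by exists e; rewrite !inE ?eT ?eqxx ?eS.
Qed.

Lemma mul_box_lb (a c K u v : int) : 0 <= a -> 0 <= c -> 0 <= K ->
  - a <= u <= K * a -> - c <= v <= K * c -> 0 <= a * c * K + u * v.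
Proof.
move=> a0 c0 K0 /andP[u1 u2] /andP[v1 v2].
have Kac : 0 <= a * c * K by rewrite !mulr_ge0.
have [u0|u0] := lerP 0 u; have [v0|v0] := lerP 0 v.
- by rewrite addr_ge0 ?mulr_ge0.
- have h1 : 0 <= (K * a - u) * c by rewrite mulr_ge0 // subr_ge0.
  have h2 : 0 <= u * (v + c) by rewrite mulr_ge0 // -lerBlDr sub0r.
  by have := addr_ge0 h1 h2; congr (_ <= _); ring.
- have h1 : 0 <= (K * c - v) * a by rewrite mulr_ge0 // subr_ge0.
  have h2 : 0 <= (u + a) * v by rewrite mulr_ge0 // -lerBlDr sub0r.
  by have := addr_ge0 h1 h2; congr (_ <= _); ring.
- by rewrite addr_ge0 // mulr_le0 // ltW.
Qed.

Section SetFunction.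
Variables (R : realType) (n : nat) (sA sB H : {set 'I_n}) (K N D : nat).
Variables (eps kap : R).
Hypothesis K_gt0 : (0 < K)%N.
Hypothesis eps_ge0 : 0 <= eps.
Hypothesis kap_ge0 : 0 <= kap.

Definition phi (a c u v : int) : R :=
  a%:~R * c%:~R + flatmul D eps u v / K%:R
  + kap * (a%:~R * (N%:R - a%:~R) + c%:~R * (N%:R - c%:~R)).

Definition wt (e : 'I_n) : int := if e \in H then K%:Z else -1.

Definition bal (X : {set 'I_n}) : int := \sum_(e in X) wt e.

Definition hard (S : {set 'I_n}) : R :=
  phi #|sA :&: S| #|sB :\: S| (bal (sA :&: S)) (bal (sB :\: S)).

Lemma hard_flat (S : {set 'I_n}) :
  (`|bal (sA :&: S)| <= D)%N -> (`|bal (sB :\: S)| <= D)%N ->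
  hard S = phi #|sA :&: S| #|sB :\: S| 0 0.
Proof. by move=> uD vD; rewrite /hard /phi !flatmul_flat. Qed.

Lemma bal_bounds (X : {set 'I_n}) : - #|X|%:Z <= bal X <= K%:Z * #|X|%:Z.
Proof.
have -> : #|X|%:Z = \sum_(e in X) 1 by rewrite sumr_const natz.
rewrite mulr_sumr -sumrN.
apply/andP; split; apply: ler_sum => e _; rewrite /wt; case: ifP => _; lia.
Qed.

Section Bounds.
Hypotheses (cardA : #|sA| = N) (cardB : #|sB| = N).

Lemma card_interA (S : {set 'I_n}) : (#|sA :&: S| <= N)%N.
Proof. by rewrite -cardA subset_leq_card // finset.subsetIl. Qed.

Lemma card_diffB (S : {set 'I_n}) : (#|sB :\: S| <= N)%N.
Proof. by rewrite -cardB subset_leq_card // finset.subsetDl. Qed.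

Lemma quad_ge0 (a : nat) : (a <= N)%N -> 0 <= (a%:~R : R) * (N%:R - a%:~R).
Proof. by move=> aN; rewrite mulr_ge0 // subr_ge0 ler_nat. Qed.

Lemma hard_lb (S : {set 'I_n}) :
  flatmul D eps (bal (sA :&: S)) (bal (sB :\: S)) / K%:R <= hard S.
Proof.
have := quad_ge0 (card_interA S); have := quad_ge0 (card_diffB S).
have : 0 <= (#|sA :&: S|%:~R * #|sB :\: S|%:~R : R) by rewrite mulr_ge0.
move=> ac0 qb qa; rewrite /hard /phi.
by rewrite [X in _ <= X + _]addrC -addrA lerDl addr_ge0 // mulr_ge0 // addr_ge0.
Qed.

Lemma hard_ge0 : nonneg_fun hard.
Proof.
move=> S; rewrite /hard /phi.
have := quad_ge0 (card_interA S); have := quad_ge0 (card_diffB S).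
have /andP[u1 u2] := bal_bounds (sA :&: S).
have /andP[v1 v2] := bal_bounds (sB :\: S).
have K0 : (0 : R) < K%:R by rewrite ltr0n.
set a := #|sA :&: S| in u1 u2 *; set c := #|sB :\: S| in v1 v2 *.
set u := bal _ in u1 u2 *; set v := bal _ in v1 v2 *.
move=> qc qa.
suff h : 0 <= a%:R * c%:R + flatmul D eps u v / K%:R.
  by apply: addr_ge0 => //; rewrite mulr_ge0 // addr_ge0.
have := flatmul_lb D eps_ge0 u v; rewrite ge_min => /orP[h|h].
  by rewrite addr_ge0 ?mulr_ge0 // invr_ge0 ltW.
rewrite -(pmulr_lge0 _ K0) mulrDl divfK ?gt_eqF //.
apply: le_trans (lerD (lexx _) h).
rewrite -!natrM pmulrn -intrD ler0z !PoszM.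
by apply: mul_box_lb => //; apply/andP.
Qed.

Lemma hard_ub (S : {set 'I_n}) : hard S <= N%:R ^+ 2 * (1 + K%:R + 2 * kap).
Proof.
rewrite /hard /phi.
have K0 : (0 : R) < K%:R by rewrite ltr0n.
have /andP[u1 u2] := bal_bounds (sA :&: S).
have /andP[v1 v2] := bal_bounds (sB :\: S).
have aN := card_interA S; have cN := card_diffB S.
have h := flatmul_ub D eps_ge0 (bal (sA :&: S)) (bal (sB :\: S)).
have {}h : flatmul D eps (bal (sA :&: S)) (bal (sB :\: S)) / K%:R
    <= N%:R ^+ 2 * K%:R.
  rewrite ler_pdivrMr //; apply: le_trans h _.
  have -> : N%:R ^+ 2 * K%:R * K%:R = (K * N)%:R * (K * N)%:R :> R.
    by rewrite natrM; ring.
  rewrite -intrM -natrM pmulrn ler_int PoszM.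
  have bN (x : int) (p : nat) : (p <= N)%N -> - p%:Z <= x -> x <= K%:Z * p%:Z ->
      `|x| <= (K * N)%:Z.
    move=> pN x1 x2; have : (K * p <= K * N)%N by rewrite leq_mul2l pN orbT.
    have : (N <= K * N)%N by rewrite leq_pmull.
    by move: x2; rewrite -PoszM; lia.
  by apply: ler_pM => //; [exact: bN aN _ _|exact: bN cN _ _].
have a0 : 0 <= (#|sA :&: S|%:R : R) by [].
have c0 : 0 <= (#|sB :\: S|%:R : R) by [].
have aN' : (#|sA :&: S|%:R : R) <= N%:R by rewrite ler_nat.
have cN' : (#|sB :\: S|%:R : R) <= N%:R by rewrite ler_nat.
have h1 : (#|sA :&: S|%:R * #|sB :\: S|%:R : R) <= N%:R ^+ 2.
  by rewrite expr2 ler_pM.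
have h2 (a : R) : 0 <= a -> a <= N%:R -> a * (N%:R - a) <= N%:R ^+ 2.
  by move=> ? ?; rewrite expr2 ler_pM //; lra.
have qs := ler_wpM2l kap_ge0 (lerD (h2 _ a0 aN') (h2 _ c0 cN')).
apply: le_trans (lerD (lerD h1 h) qs) _.
by rewrite le_eqVlt; apply/orP; left; apply/eqP; ring.
Qed.

End Bounds.

Hypothesis eps_kap : eps * K%:R <= 2 * kap.

Lemma phiC a c u v : phi a c u v = phi c a v u.
Proof. by rewrite /phi hidC; ring. Qed.

Definition is_wt (s : int) := s \in [:: K%:Z; -1].

Lemma phi_AA a c u v s t : is_wt s -> is_wt t ->
  phi (a + 1 + 1) c (u + s + t) v - phi (a + 1) c (u + s) v
  <= phi (a + 1) c (u + t) v - phi a c u v.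
Proof.
move=> ws wt; rewrite /phi.
have st : eps * `|s * t|%:~R <= eps * (K%:R * K%:R).
  apply: ler_wpM2l => //; rewrite -natrM pmulrn ler_int.
  by move: ws wt; rewrite /is_wt !inE => /orP[]/eqP-> /orP[]/eqP->; nia.
have := flatmul_curv_step D eps_ge0 s t u v; rewrite ler_norml => /andP[_].
set h1 := flatmul _ _ (u + s + t) v; set h2 := flatmul _ _ (u + s) v.
set h3 := flatmul _ _ (u + t) v; set h4 := flatmul _ _ u v => hle.
have K0 : (0 : R) < K%:R by rewrite ltr0n.
have : (h1 - h2 - h3 + h4) / K%:R <= 2 * kap.
  rewrite ler_pdivrMr //; apply: le_trans hle _; apply: le_trans st _.
  by rewrite mulrA ler_wpM2r // ltW.
rewrite !mulrDl !mulNr !intrD; nra.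
Qed.

Lemma phi_CC a c u v s t : is_wt s -> is_wt t ->
  phi a (c + 1 + 1) u (v + s + t) - phi a (c + 1) u (v + s)
  <= phi a (c + 1) u (v + t) - phi a c u v.
Proof. by move=> ws wt; rewrite !(phiC a); exact: phi_AA. Qed.

Lemma phi_AC a c u v s t : is_wt s -> is_wt t ->
  phi (a + 1) (c - 1) (u + s) (v - t) - phi a (c - 1) u (v - t)
  <= phi (a + 1) c (u + s) v - phi a c u v.
Proof.
move=> ws wt; rewrite /phi.
have := flatmul_mixed_step D eps_ge0 s (- t) u v.
set h1 := flatmul _ _ (u + s) (v - t); set h2 := flatmul _ _ (u + s) v.
set h3 := flatmul _ _ u (v - t); set h4 := flatmul _ _ u v => hle.
have K0 : (0 : R) < K%:R by rewrite ltr0n.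
have : (h1 - h2 - h3 + h4) / K%:R <= 1.
  rewrite ler_pdivrMr // mul1r; apply: le_trans hle _.
  rewrite ge_max ler0n pmulrn ler_int /=.
  by move: ws wt; rewrite /is_wt !inE => /orP[]/eqP-> /orP[]/eqP->; nia.
rewrite !mulrDl !mulNr !intrD; nra.
Qed.

Lemma is_wt_wt e : is_wt (wt e).
Proof. by rewrite /is_wt /wt; case: ifP; rewrite !inE eqxx ?orbT. Qed.

Lemma balU1 e (X : {set 'I_n}) : e \notin X -> bal (e |: X) = bal X + wt e.
Proof. by move=> eX; rewrite /bal big_setU1 //= addrC. Qed.

Lemma inter_in e (S : {set 'I_n}) : e \in sA -> e \notin S ->
  sA :&: (e |: S) = e |: (sA :&: S).
Proof.
move=> eA eS; apply/setP => x; rewrite !inE.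
by case: eqVneq => // ->; rewrite eA.
Qed.

Lemma inter_out e (S : {set 'I_n}) : e \notin sA -> sA :&: (e |: S) = sA :&: S.
Proof.
move=> eA; apply/setP => x; rewrite !inE.
by case: eqVneq => // ->; rewrite (negPf eA).
Qed.

Lemma diff_in e (S : {set 'I_n}) : e \in sB -> e \notin S ->
  sB :\: S = e |: (sB :\: (e |: S)).
Proof.
move=> eB eS; apply/setP => x; rewrite !inE.
by case: eqVneq => // ->; rewrite eB eS.
Qed.

Lemma diff_out e (S : {set 'I_n}) : e \notin sB -> sB :\: (e |: S) = sB :\: S.
Proof.
move=> eB; apply/setP => x; rewrite !inE.
by case: eqVneq => // ->; rewrite (negPf eB) !andbF.
Qed.

Lemma hard_inA e (S : {set 'I_n}) : e \in sA -> e \notin sB -> e \notin S ->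
  hard (e |: S) = phi (#|sA :&: S|%:Z + 1) #|sB :\: S|
                      (bal (sA :&: S) + wt e) (bal (sB :\: S)).
Proof.
move=> eA eB eS; rewrite /hard diff_out // inter_in //.
have eAS : e \notin sA :&: S by rewrite !inE (negPf eS) andbF.
by rewrite balU1 // cardsU1 eAS /= add1n -addn1 PoszD.
Qed.

Lemma hard_inB e (S : {set 'I_n}) : e \in sB -> e \notin sA -> e \notin S ->
  hard (e |: S) = phi #|sA :&: S| (#|sB :\: S|%:Z - 1)
                      (bal (sA :&: S)) (bal (sB :\: S) - wt e).
Proof.
move=> eB eA eS; rewrite /hard inter_out // (diff_in eB eS).
have eBS : e \notin sB :\: (e |: S) by rewrite !inE eqxx.
by rewrite balU1 // cardsU1 eBS /= add1n -addn1 PoszD !addrK.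
Qed.

Lemma hard_out e (S : {set 'I_n}) : e \notin sA -> e \notin sB -> hard (e |: S) = hard S.
Proof. by move=> eA eB; rewrite /hard inter_out // diff_out. Qed.

Hypothesis disjAB : [disjoint sA & sB].

Lemma AnotB e : e \in sA -> e \notin sB.
Proof. by move=> eA; rewrite (disjointFr disjAB eA). Qed.

Lemma hard_submodular : submodular hard.
Proof.
apply: submodular_local => S e e' eS e'S ee'.
have eS' : e \notin e' |: S by rewrite !inE negb_or ee'.
have [eA|eA] := boolP (e \in sA).
  have eB := AnotB eA; rewrite !(hard_inA eA eB) //.
  have [e'A|e'A] := boolP (e' \in sA).
    have e'B := AnotB e'A; rewrite (hard_inA e'A e'B) // inter_in // diff_out //.
    have e'AS : e' \notin sA :&: S by rewrite !inE (negPf e'S) andbF.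
    rewrite balU1 // cardsU1 e'AS /= add1n -addn1 PoszD.
    have := phi_AA #|sA :&: S|%:Z #|sB :\: S|%:Z (bal (sA :&: S))
      (bal (sB :\: S)) (is_wt_wt e') (is_wt_wt e).
    by rewrite /hard; lra.
  have [e'B|e'B] := boolP (e' \in sB).
    rewrite (hard_inB e'B e'A) // inter_out // /hard.
    have := phi_AC #|sA :&: S|%:Z #|sB :\: S|%:Z (bal (sA :&: S))
      (bal (sB :\: S)) (is_wt_wt e) (is_wt_wt e').
    rewrite (diff_in e'B e'S).
    have e'BS : e' \notin sB :\: (e' |: S) by rewrite !inE eqxx.
    by rewrite balU1 // cardsU1 e'BS /= add1n -addn1 PoszD !addrK.
  by rewrite hard_out // inter_out // diff_out.
have [eB|eB] := boolP (e \in sB); last by rewrite !(hard_out _ eA eB) !subrr.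
rewrite !(hard_inB eB eA) //.
have [e'A|e'A] := boolP (e' \in sA).
  have e'B := AnotB e'A; rewrite (hard_inA e'A e'B) // inter_in // diff_out //.
  have e'AS : e' \notin sA :&: S by rewrite !inE (negPf e'S) andbF.
  rewrite balU1 // cardsU1 e'AS /= add1n -addn1 PoszD /hard.
  have := phi_AC #|sA :&: S|%:Z #|sB :\: S|%:Z (bal (sA :&: S))
    (bal (sB :\: S)) (is_wt_wt e') (is_wt_wt e).
  by lra.
have [e'B|e'B] := boolP (e' \in sB).
  rewrite (hard_inB e'B e'A) // inter_out // /hard (diff_in e'B e'S).
  have e'BS : e' \notin sB :\: (e' |: S) by rewrite !inE eqxx.
  rewrite balU1 // cardsU1 e'BS /= add1n -addn1 PoszD !addrK.
  set c := #|sB :\: _|%:Z; set v := bal (sB :\: _).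
  have := phi_CC #|sA :&: S|%:Z (c - 1) (bal (sA :&: S)) (v - wt e)
     (is_wt_wt e) (is_wt_wt e').
  have -> : v - wt e + wt e + wt e' = v + wt e' by rewrite subrK.
  have -> : v - wt e + wt e' = v + wt e' - wt e by rewrite addrAC.
  by rewrite !subrK; lra.
by rewrite hard_out // inter_out // diff_out.
Qed.

End SetFunction.

(** * Tail bound *)

Section Tail.
Variables (R : realType) (m k : nat).

Lemma expR_le_quadratic (x : R) : `|x| <= 1 / 2 ->
  expR x <= 1 + x + 2 * x ^+ 2.
Proof.
rewrite ler_norml => /andP[x1 x2].
have eV : expR x * expR (- x) = 1 by rewrite -expRD subrr expR0.
have h := expR_ge1Dx (- x).
have e0 := expR_gt0 x.
have ex1 := ler_wpM2l (ltW e0) h; rewrite eV in ex1.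
have x0 : 0 < 1 - x by lra.
rewrite -(ler_pM2r x0); apply: le_trans ex1 _.
have := mulr_ge0 (sqr_ge0 x) (_ : 0 <= 1 - 2 * x); rewrite !expr2 => q.
have {}q := q ltac:(lra).
have -> : (1 + x + 2 * (x * x)) * (1 - x) = 1 + x * x * (1 - 2 * x) by ring.
lra.
Qed.

Lemma exp_moment (X : 'I_m -> 'I_k -> R) (b l : R) :
  (forall j, \sum_i X j i = 0) -> (forall j i, `|X j i| <= b) ->
  0 <= l -> l * b <= 1 / 2 ->
  \sum_(h : {ffun 'I_m -> 'I_k}) expR (l * \sum_j X j (h j))
  <= k%:R ^+ m * expR (2 * (l * b) ^+ 2 * m%:R).
Proof.
move=> X0 Xb l0 lb.
have -> : \sum_(h : {ffun 'I_m -> 'I_k}) expR (l * \sum_j X j (h j))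
        = \prod_j \sum_i expR (l * X j i).
  rewrite bigA_distr_bigA; apply: eq_bigr => h _.
  by rewrite mulr_sumr expR_sum.
have -> : k%:R ^+ m * expR (2 * (l * b) ^+ 2 * m%:R)
        = \prod_(j < m) (k%:R * expR (2 * (l * b) ^+ 2)).
  by rewrite prodr_const card_ord [RHS]exprMn expRM_natr.
apply: ler_prod => j _; apply/andP; split.
  by apply: sumr_ge0 => i _; rewrite expR_ge0.
apply: (@le_trans _ _ (\sum_(i < k) (1 + l * X j i + 2 * (l * b) ^+ 2))).
  apply: ler_sum => i _.
  have lX : `|l * X j i| <= l * b by rewrite normrM ger0_norm // ler_wpM2l.
  apply: le_trans (expR_le_quadratic (le_trans lX lb)) _.
  rewrite lerD2l ler_wpM2l // -real_normK ?num_real // lerXn2r // nnegrE //.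
  exact: le_trans lX.
rewrite !big_split /= -mulr_sumr X0 mulr0 addr0 !sumr_const card_ord.
rewrite -mulrnDl -[leLHS]mulr_natl ler_wpM2l //; exact: expR_ge1Dx.
Qed.

Lemma tail_count1 (X : 'I_m -> 'I_k -> R) (b t : R) :
  (forall j, \sum_i X j i = 0) -> (forall j i, `|X j i| <= b) ->
  0 < b -> 0 <= t -> t <= 2 * b ->
  #|[set h : {ffun 'I_m -> 'I_k} | t * m%:R <= \sum_j X j (h j)]|%:R
  <= k%:R ^+ m * expR (- (t ^+ 2 / (8 * b ^+ 2)) * m%:R).
Proof.
move=> X0 Xb b0 t0 tb; set bad := [set h | _].
pose l := t / (4 * b ^+ 2).
have bn0 : b != 0 by rewrite gt_eqF.
have l0 : 0 <= l by rewrite divr_ge0 // mulr_ge0 // sqr_ge0.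
have lb : l * b <= 1 / 2.
  have -> : l * b = t / (4 * b) by rewrite /l; field.
  by rewrite ler_pdivrMr; lra.
have e0 := expR_gt0 (l * (t * m%:R)).
rewrite -(ler_pM2r e0) -[leRHS]mulrA -expRD.
have -> : - (t ^+ 2 / (8 * b ^+ 2)) * m%:R + l * (t * m%:R)
          = 2 * (l * b) ^+ 2 * m%:R by rewrite /l; field.
apply: le_trans (exp_moment X0 Xb l0 lb).
rewrite -sum1_card natr_sum mulr_suml [leRHS](bigID (mem bad)) /=.
rewrite -[leLHS]addr0; apply: lerD; last first.
  by apply: sumr_ge0 => h _; rewrite expR_ge0.
apply: ler_sum => h; rewrite inE mul1r => hb.
by rewrite ler_expR ler_wpM2l.
Qed.

Lemma tail_count (X : 'I_m -> 'I_k -> R) (b t : R) :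
  (forall j, \sum_i X j i = 0) -> (forall j i, `|X j i| <= b) ->
  0 < b -> 0 <= t -> t <= 2 * b ->
  #|[set h : {ffun 'I_m -> 'I_k} | t * m%:R <= `|\sum_j X j (h j)|]|%:R
  <= 2 * k%:R ^+ m * expR (- (t ^+ 2 / (8 * b ^+ 2)) * m%:R).
Proof.
move=> X0 Xb b0 t0 tb.
have h1 := tail_count1 X0 Xb b0 t0 tb.
have h2 : #|[set h : {ffun 'I_m -> 'I_k}
            | t * m%:R <= \sum_j - X j (h j)]|%:R
  <= k%:R ^+ m * expR (- (t ^+ 2 / (8 * b ^+ 2)) * m%:R).
  by apply: (@tail_count1 (fun j i => - X j i)) => // [j|j i];
    rewrite ?sumrN ?X0 ?oppr0 ?normrN.
apply: (@le_trans _ _ (_ + _)); last first.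
  apply: (le_trans (lerD h1 h2)); set a := _ ^+ m; set e := expR _; lra.
rewrite -natrD ler_nat; apply: leq_trans (leq_card_setU _ _).
apply: subset_leq_card; apply/fintype.subsetP => h; rewrite !inE sumrN.
by rewrite ler_normr.
Qed.

End Tail.

(** * Value-oracle algorithms and feasible sets *)

Fixpoint queries (R : realType) (n : nat) (strat : history R n -> action n)
    (f : {set 'I_n} -> R) (q : nat) (h : history R n) : seq {set 'I_n} :=
  match strat h, q with
  | inl Q, q'.+1 => Q :: queries strat f q' (rcons h (Q, f Q))
  | _, _ => [::]
  end.

Lemma size_queries (R : realType) (n : nat) (strat : history R n -> action n)
    (f : {set 'I_n} -> R) (q : nat) (h : history R n) :
  (size (queries strat f q h) <= q)%N.
Proof.
by elim: q h => [|q IHq] h /=; case: (strat h) => //= Q; exact: IHq.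
Qed.

Lemma run_agree (R : realType) (n : nat) (strat : history R n -> action n)
    (f g : {set 'I_n} -> R) (q : nat) (h : history R n) :
  {in queries strat g q h, f =1 g} -> run strat f q h = run strat g q h.
Proof.
elim: q h => [|q IHq] h /=; case: (strat h) => //= Q fg.
rewrite (fg Q) ?mem_head //; apply: IHq => T TQ.
by apply: fg; rewrite inE TQ orbT.
Qed.

Lemma sum_chi (R : realType) (n : nat) (B X : {set 'I_n}) :
  \sum_(u in X) chi R B u = #|B :&: X|%:R.
Proof.
rewrite -[in RHS]sum1_card natr_sum /chi -big_mkcondr /=.
by apply: eq_bigl => u; rewrite !inE andbC.
Qed.

Lemma polytope_sum (R : realType) (n : nat) (part : 'I_n -> nat)
    (r : nat -> nat) (y : 'I_n -> R) (X : {set 'I_n}) (c : nat) :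
  (forall B, is_base part r B -> #|B :&: X| = c) ->
  in_base_polytope part r y -> \sum_(u in X) y u = c%:R.
Proof.
move=> Xc [lam [lam0 [lamB [lam1 yE]]]].
under eq_bigr do rewrite yE.
rewrite exchange_big /= -[RHS]mul1r -[X in X * _]lam1 mulr_suml; apply: eq_bigr => B _.
have [->|/lamB/Xc <-] := eqVneq (lam B) 0.
  by rewrite mul0r big1 // => u _; rewrite mul0r.
by rewrite -mulr_sumr sum_chi.

Qed.

Lemma feasible_card (R : realType) (n : nat) (part : 'I_n -> nat)
    (r : nat -> nat) (beta : R) (S X : {set 'I_n}) (c : nat) :
  (forall B, is_base part r B -> #|B :&: X| = c) ->
  bicriteria_feasible part r beta S ->
  (c <= #|S :&: X|)%N /\ #|S :&: X|%:R <= beta * c%:R.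
Proof.
move=> Xc [y1 [y2 [y1P [y2P [yS Sy]]]]]; split.
  rewrite -(ler_nat R) -(polytope_sum Xc y1P) -sum_chi.
  by apply: ler_sum => u _; exact: yS.
rewrite -(polytope_sum Xc y2P) -sum_chi mulr_sumr.
by apply: ler_sum => u _; exact: Sy.
Qed.

Lemma exists_opt (R : realType) (n : nat) (part : 'I_n -> nat)
    (r : nat -> nat) (f : {set 'I_n} -> R) (B : {set 'I_n}) :
  is_base part r B -> exists2 O, is_opt part r f O & f B <= f O.
Proof.
move=> bB; pose P S := `[< is_base part r S >].
have PB : P B by apply/asboolP.
case: (Order.TotalTheory.arg_maxP f PB) => O /asboolP bO Omax.
by exists O; [split=> // C bC; apply: Omax; apply/asboolP|exact: Omax].
Qed.

Lemma averaging (R : realType) (d : measure_display) (Omega : measurableType d)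
    (P : probability Omega R) (n : nat) (I : finType)
    (out : I -> Omega -> {set 'I_n}) (f : I -> {set 'I_n} -> R)
    (V : I -> R) (B : R) :
  (forall i T, measurable [set w | out i w = T]) ->
  (forall i T, 0 <= f i T) ->
  (forall i, ((V i)%:E <= \int[P]_w (f i (out i w))%:E)%E) ->
  (forall w, \sum_i f i (out i w) <= B) ->
  \sum_i V i <= B.
Proof.
move=> mout f0 Vle fB.
have mf i : measurable_fun [set: Omega] (EFin \o (fun w => f i (out i w))).
  apply/measurable_EFinP => _ Y mY; rewrite setTI.
  have -> : ((fun w => f i (out i w)) @^-1` Y)%classic
      = (\bigcup_(T in [set T | Y (f i T)]) [set w | out i w = T])%classic.
    apply/seteqP; split => [w Yw|w [T YT /= wT]]; first by exists (out i w).
    by rewrite /= wT.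
  by apply: fin_bigcup_measurable => //; exact: finite_finset.
have f0' i w : setT w -> (0 <= (f i (out i w))%:E)%E by rewrite lee_fin.
rewrite -lee_fin -sumEFin.
apply: (@le_trans _ _ (\sum_i \int[P]_w (f i (out i w))%:E)%E).
  by apply: lee_sum => i _; exact: Vle.
rewrite -ge0_integral_sum //.
apply: (@le_trans _ _ (\int[P]_w (cst B%:E w))%E); last first.
  have P1 : P setT = 1%E by exact: probability_setT.
  rewrite integral_cst; last exact: measurableT.
  by rewrite [X in (_ * X)%E]P1 mule1.
apply: ge0_le_integral => //.
- by move=> w _; apply: sume_ge0 => i _; exact: f0'.
- exact: emeasurable_sum.
- by move=> w _; rewrite sumEFin lee_fin.
Qed.

(** * The partition matroid and its planted bases *)

Section Instance.
Variables (n m K : nat).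
Local Notation k := K.+1.
Hypothesis mn : (2 * m * k <= n)%N.

Lemma elt_subproof (b : bool) (j : 'I_m) (i : 'I_k) : ((b * m + j) * k + i < n)%N.
Proof.
apply: leq_trans mn; have jm := ltn_ord j; have ik := ltn_ord i.
have : ((b * m + j).+1 * k <= 2 * m * k)%N.
  by rewrite leq_mul2r; apply/orP; right; case: b; lia.
by rewrite mulSn; lia.
Qed.

Definition elt (b : bool) (j : 'I_m) (i : 'I_k) : 'I_n :=
  Ordinal (elt_subproof b j i).

Definition part (e : 'I_n) : nat := (e %/ k)%N.

Definition rank (l : nat) : nat :=
  if (l < m)%N then 1%N else if (l < 2 * m)%N then K else 0%N.

Lemma part_elt b j i : part (elt b j i) = (b * m + j)%N.
Proof. by rewrite /part /= divnMDl // divn_small // addn0. Qed.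

Lemma elt_inj b b' j j' i i' : elt b j i = elt b' j' i' ->
  [/\ b = b', j = j' & i = i'].
Proof.
move=> ee; have := congr1 part ee; rewrite !part_elt => bj.
have [bb jj] : b = b' /\ j = j' :> nat.
  have j1 := ltn_ord j; have j2 := ltn_ord j'.
  by move: bj; case: (b); case: (b') => bj; split=> //; lia.
split=> //; apply/val_inj => //.
by move/(congr1 val): ee; rewrite /= bj => /addnI.
Qed.

Definition side (b : bool) : {set 'I_n} :=
  [set elt b p.1 p.2 | p : 'I_m * 'I_k].

Lemma elt_side b b' j i : (elt b j i \in side b') = (b == b').
Proof.
apply/imsetP/eqP => [[[j' i'] _ /elt_inj[]]//|<-].
by exists (j, i).
Qed.

Lemma big_side (T : Type) (x : T) (op : Monoid.com_law x) (F : 'I_n -> T) b :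
  \big[op/x]_(e in side b) F e = \big[op/x]_j \big[op/x]_i F (elt b j i).
Proof.
rewrite big_imset /=; last by move=> [j i] [j' i'] _ _ /elt_inj[_ /= -> ->].
by rewrite pair_bigA.
Qed.

Lemma blockE (b : bool) (j : 'I_m) : block part (b * m + j) = [set elt b j i | i : 'I_k].
Proof.
apply/setP => e; rewrite inE; apply/eqP/imsetP => [pe|[i _ ->]]; last first.
  exact: part_elt.
exists (inord (e %% k)) => //; apply/val_inj => /=.
by rewrite inordK ?ltn_mod // -pe /part -divn_eq.
Qed.

Lemma big_block (T : Type) (x : T) (op : Monoid.com_law x) (F : 'I_n -> T)
    (b : bool) (j : 'I_m) :
  \big[op/x]_(e in block part (b * m + j)) F e = \big[op/x]_i F (elt b j i).
Proof.
by rewrite blockE big_imset //= => i i' _ _ /elt_inj[].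
Qed.

Lemma label_split l : (l < 2 * m)%N -> exists (b : bool) (j : 'I_m), l = (b * m + j)%N.
Proof.
move=> lm; have [lm'|ml] := ltnP l m.
  by exists false, (Ordinal lm').
have lm' : (l - m < m)%N by lia.
by exists true, (Ordinal lm'); rewrite /=; lia.
Qed.

Lemma rankE (b : bool) (j : 'I_m) : rank (b * m + j) = if b then K else 1%N.
Proof.
have jm := ltn_ord j; rewrite /rank; case: b => /=.
  by rewrite ltnNge mul1n leq_addr /= ifT //; lia.
by rewrite mul0n add0n jm.
Qed.

Lemma rank_out l : (2 * m <= l)%N -> rank l = 0%N.
Proof. by move=> ml; rewrite /rank !ltnNge ml /= ifF //; lia. Qed.

Lemma cardI (T : finType) (X Y : {set T}) : #|X :&: Y| = (\sum_(e in Y) (e \in X))%N.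
Proof.
rewrite -sum1_card [RHS]big_mkcond /= [LHS]big_mkcond /=; apply: eq_bigr => e _.
by rewrite inE; case: (e \in X); case: (e \in Y).
Qed.

Lemma pm_valid : (0 < K)%N -> valid_pm part rank.
Proof.
move=> K0 l; have [lm|ml] := ltnP l (2 * m); last by rewrite rank_out.
have [b [j ->]] := label_split lm.
rewrite rankE -sum1_card big_block sum1_card card_ord.
by case: b => //; lia.
Qed.

Lemma base_side b B : is_base part rank B ->
  #|B :&: side b| = (m * if b then K else 1)%N.
Proof.
move=> bB; rewrite cardI big_side.
under eq_bigr => j _ do rewrite -(@big_block _ _ _ (fun e => (e \in B) : nat))
  -cardI bB rankE.
by rewrite sum_nat_const card_ord.
Qed.

Lemma card_side b : #|side b| = (m * k)%N.
Proof.
rewrite -sum1_card big_side.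
under eq_bigr => j _ do rewrite sum1_card card_ord.
by rewrite sum_nat_const card_ord.
Qed.

Lemma side_disjoint : [disjoint side false & side true].
Proof.
rewrite -setI_eq0; apply/eqP/setP => e; rewrite !inE.
by apply/negP => /andP[/imsetP[[j i] _ ->]]; rewrite elt_side.
Qed.

Section Planted.
Variable h : {ffun 'I_m -> 'I_k}.

Definition hidden : {set 'I_n} := [set elt p.1 p.2 (h p.2) | p : bool * 'I_m].

Lemma elt_hidden b j i : (elt b j i \in hidden) = (i == h j).
Proof.
apply/imsetP/eqP => [[[b' j'] _ /elt_inj[_ -> ->]]//|->].
by exists (b, j).
Qed.

Definition planted : {set 'I_n} :=
  (side false :&: hidden) :|: (side true :\: hidden).

Lemma elt_planted b j i : (elt b j i \in planted) = b (+) (i == h j).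
Proof. by rewrite !inE !elt_side elt_hidden; case: b; case: (i == h j). Qed.

Lemma sum_eq_h j : (\sum_i (i == h j))%N = 1%N.
Proof. by rewrite (bigD1 (h j)) //= eqxx big1 // => i /negPf->. Qed.

Lemma planted_base : is_base part rank planted.
Proof.
move=> l; have [lm|ml] := ltnP l (2 * m); last first.
  rewrite rank_out //; apply/eqP; rewrite cards_eq0; apply/eqP/setP => e.
  rewrite !inE; apply/negP => /andP[pe /eqP el].
  have [b [j [i ee]]] : exists b j i, e = elt b j i.
    by case/orP: pe => /andP[]; [move/imsetP|move=> _ /imsetP]; case=> -[j i] _ ->;
      [exists false, j, i|exists true, j, i].
  by move: ml; rewrite -el ee part_elt; have := ltn_ord j; case: (b); lia.
have [b [j ->]] := label_split lm; rewrite cardI big_block rankE.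
under eq_bigr do rewrite elt_planted.
case: b; last exact: sum_eq_h.
have := sum_eq_h j; have : (\sum_(i < k) 1 = k)%N by rewrite sum1_card card_ord.
rewrite (eq_bigr (fun i => (i == h j) + (true (+) (i == h j))))%N; last first.
  by move=> i _; case: (i == h j).
by rewrite big_split /= => /[swap] ->; rewrite add1n => -[].
Qed.

Lemma planted_false : side false :&: planted = side false :&: hidden.
Proof.
apply/setP => e; rewrite [LHS]inE [RHS]inE; apply: andb_id2l.
by case/imsetP=> -[j i] _ ->; rewrite elt_planted elt_hidden.
Qed.

Lemma planted_true : side true :\: planted = side true :&: hidden.
Proof.
apply/setP => e; rewrite [LHS]inE [RHS]inE andbC; apply: andb_id2l.
by case/imsetP=> -[j i] _ ->; rewrite elt_planted elt_hidden /= negbK.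
Qed.

Lemma bal_hidden b : bal hidden K (side b :&: hidden) = (K * m)%:Z.
Proof.
rewrite /bal (eq_bigr (fun=> K%:Z)); last first.
  by move=> e; rewrite inE => /andP[_ eh]; rewrite /wt eh.
rewrite sumr_const finset.setIC cardI big_side.
under eq_bigr => j _.
  under eq_bigr do rewrite elt_hidden.
  rewrite sum_eq_h; over.
by rewrite sum1_card card_ord -mulr_natr natz -PoszM.
Qed.

End Planted.

Lemma bal_sum (h : {ffun 'I_m -> 'I_k}) b X :
  bal (hidden h) K (side b :&: X) =
  \sum_j \sum_i if elt b j i \in X then if i == h j then K%:Z else -1 else 0.
Proof.
rewrite /bal (eq_bigl (fun e => (e \in side b) && (e \in X))); last first.
  by move=> e; rewrite inE.
rewrite big_mkcondr big_side; apply: eq_bigr => j _; apply: eq_bigr => i _.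
by rewrite /wt elt_hidden.
Qed.

Lemma unbalanced_count (R : realType) b X (D : nat) (t : R) :
  (0 < K)%N -> 0 <= t -> t <= 2 * (k * K)%:R -> t * m%:R <= D%:R ->
  #|[set h : {ffun 'I_m -> 'I_k}
     | (D < `|bal (hidden h) K (side b :&: X)|)%N]|%:R
  <= 2 * k%:R ^+ m * expR (- (t ^+ 2 / (8 * (k * K)%:R ^+ 2)) * m%:R).
Proof.
move=> K0 t0 tk tD.
pose Y j (i0 : 'I_k) : R :=
  (\sum_i if elt b j i \in X then if i == i0 then K%:Z else -1 else 0)%:~R.
have Y0 j : \sum_i Y j i = 0.
  rewrite -(raddf_sum intr) /= exchange_big /= big1 // => i _.
  case: (elt b j i \in X); last by rewrite big1.
  rewrite (bigD1 i) //= eqxx (eq_bigr (fun=> -1)); last first.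
    by move=> i' ii'; rewrite eq_sym (negPf ii').
  rewrite sumr_const cardC1 card_ord /= mulNrn natz; exact: subrr.
have Yb j i : `|Y j i| <= (k * K)%:R.
  rewrite -intr_norm pmulrn ler_int; apply: le_trans (ler_norm_sum _ _ _) _.
  rewrite PoszM -[k%:Z]natz -[k in leRHS]card_ord mulr_natl -sumr_const.
  by apply: ler_sum => i' _; case: ifP => // _; case: ifP.
have kK : 0 < (k * K)%:R :> R by rewrite ltr0n muln_gt0.
apply: le_trans (tail_count Y0 Yb kK t0 tk).
rewrite ler_nat; apply: subset_leq_card; apply/fintype.subsetP => h.
rewrite !inE bal_sum => Dh; apply: le_trans tD _.
rewrite -(raddf_sum intr) /= -intr_norm pmulrn ler_int -abszE lez_nat; exact: ltnW.
Qed.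

End Instance.

(** * The query lower bound *)

Lemma card_has_le (R : realType) (I : finType) (T : Type) (p : I -> T -> bool)
    (s : seq T) (b : R) :
  (forall x, #|[set i | p i x]|%:R <= b) ->
  #|[set i | has (p i) s]|%:R <= (size s)%:R * b.
Proof.
move=> pb; elim: s => [|x s IHs] /=.
  by rewrite mul0r eq_card0 // => i; rewrite !inE.
rewrite -natr1 mulrDl mul1r addrC; apply: le_trans (lerD (pb x) IHs).
rewrite -natrD ler_nat; apply: leq_trans (leq_card_setU _ _).
by apply: subset_leq_card; apply/fintype.subsetP => i; rewrite !inE.
Qed.

Section Core.
Variables (R : realType) (alpha beta : R) (n m K : nat).
Local Notation k := K.+1.
Hypothesis mn : (2 * m * k <= n)%N.
Hypotheses (K_gt0 : (0 < K)%N) (alpha_gt0 : 0 < alpha).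

Let L := (k * k)%N.
Let D := (m %/ 2 ^ L.+1)%N.
Let N := (m * k)%N.
Let eps : R := (k%:R ^+ 2)^-1.
Let kap : R := k%:R^-1.

Hypothesis m_large : (2 ^ L.+1 <= m)%N.

Let sA := side mn false.
Let sB := side mn true.

Definition planted_fun (h : {ffun 'I_m -> 'I_k}) : {set 'I_n} -> R :=
  hard sA sB (hidden mn h) K N D eps kap.

Definition flat_fun (S : {set 'I_n}) : R :=
  phi K N D eps kap #|sA :&: S| #|sB :\: S| 0 0.

Let k_gt0 : (0 : R) < k%:R.
Proof. by rewrite ltr0n. Qed.

Let m_gt0 : (0 < m)%N.
Proof. by apply: leq_trans m_large; rewrite expn_gt0. Qed.

Let eps_ge0 : 0 <= eps.
Proof. by rewrite invr_ge0 sqr_ge0. Qed.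

Let kap_ge0 : 0 <= kap.
Proof. by rewrite invr_ge0 ltW. Qed.

Let eps_kap : eps * K%:R <= 2 * kap.
Proof.
rewrite /eps mulrC ler_pdivrMr ?exprn_gt0 // /kap expr2 mulrA divfK ?gt_eqF //.
have : (K%:R : R) <= k%:R by rewrite ler_nat.
by have : (0 : R) <= k%:R by []; lra.
Qed.

Let cardA : #|sA| = N := card_side mn false.
Let cardB : #|sB| = N := card_side mn true.

Lemma planted_fun_submodular h : submodular (planted_fun h).
Proof. by apply: hard_submodular => //; exact: side_disjoint. Qed.

Lemma planted_fun_ge0 h : nonneg_fun (planted_fun h).
Proof. exact: hard_ge0. Qed.

Lemma planted_value h :
  K%:R * m%:R ^+ 2 / 4 <= planted_fun h (planted mn h).
Proof.
apply: le_trans _ (hard_lb _ _ _ _ kap_ge0 cardA cardB _).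
rewrite planted_false planted_true !bal_hidden.
have K0 : (0 : R) < K%:R by rewrite ltr0n.
rewrite ler_pdivlMr //.
have D0 : (0 < D)%N by rewrite divn_gt0 // expn_gt0.
have eL : 1 <= eps * L%:R.
  by rewrite /eps /L natrM -expr2 mulVf // expf_neq0 // gt_eqF.
have DM : (2 * (2 ^ L * D) <= K * m)%N.
  rewrite mulnA -expnS mulnC; apply: (@leq_trans m); first exact: leq_trunc_div.
  exact: leq_pmull.
apply: le_trans _ (flatmul_large eps_ge0 D0 eL DM).
by rewrite natrM exprMn; lra.
Qed.

Definition unbalanced (h : {ffun 'I_m -> 'I_k}) (S : {set 'I_n}) : bool :=
  (D < `|bal (hidden mn h) K (sA :&: S)|)%N
  || (D < `|bal (hidden mn h) K (sB :\: S)|)%N.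

Lemma planted_flat h S : ~~ unbalanced h S -> planted_fun h S = flat_fun S.
Proof. by rewrite negb_or -!leqNgt => /andP[? ?]; exact: hard_flat. Qed.

Definition rate : R :=
  ((2 ^ L.+2)%:R^-1) ^+ 2 / (8 * (k * K)%:R ^+ 2).

Lemma unbalanced_rare S :
  #|[set h | unbalanced h S]|%:R
  <= 4 * k%:R ^+ m * expR (- rate * m%:R).
Proof.
set t : R := (2 ^ L.+2)%:R^-1.
have p0 : (0 : R) < (2 ^ L.+2)%:R by rewrite ltr0n expn_gt0.
have t0 : 0 <= t by rewrite invr_ge0 ltW.
have tk : t <= 2 * (k * K)%:R.
  apply: (@le_trans _ _ 1).
    by rewrite invf_le1 // ler1n expn_gt0.
  by rewrite -natrM ler1n !muln_gt0.
have tD : t * m%:R <= D%:R.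
  rewrite mulrC ler_pdivrMr // -natrM ler_nat.
  have D0 : (0 < D)%N by rewrite divn_gt0 // expn_gt0.
  have := ltn_ceil m (_ : 0 < 2 ^ L.+1)%N; rewrite -/D expn_gt0 => /(_ isT).
  rewrite mulSn [(2 ^ L.+2)%N]expnS.
  have : (2 ^ L.+1 <= D * 2 ^ L.+1)%N by rewrite leq_pmull.
  by lia.
have hA := unbalanced_count mn false S K_gt0 t0 tk tD.
have hB := unbalanced_count mn true (~: S) K_gt0 t0 tk tD.
have -> : 4 * k%:R ^+ m * expR (- rate * m%:R)
  = 2 * k%:R ^+ m * expR (- rate * m%:R)
    + 2 * k%:R ^+ m * expR (- rate * m%:R) by ring.
apply: le_trans (lerD hA hB).
rewrite -natrD ler_nat; apply: leq_trans (leq_card_setU _ _).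
apply: subset_leq_card; apply/fintype.subsetP => h.
by rewrite !inE /unbalanced finset.setDE.
Qed.

Lemma flat_feasible S : bicriteria_feasible (@part n K) (rank m K) beta S ->
  flat_fun S <= m%:R ^+ 2 * (2 * beta + 1).
Proof.
move=> feas.
have [_ Ale] := feasible_card (@base_side _ _ _ mn false) feas.
have [Cge _] := feasible_card (@base_side _ _ _ mn true) feas.
rewrite muln1 finset.setIC -/sA in Ale.
have Cle : (#|sB :\: S| <= m)%N.
  rewrite cardsD card_side finset.setIC -/sB.
  by move: Cge; rewrite -/sB mulnS; lia.
have C0 : (0 : R) <= #|sB :\: S|%:R by [].
have A0 : (0 : R) <= #|sA :&: S|%:R by [].
have CR : (#|sB :\: S|%:R : R) <= m%:R by rewrite ler_nat.
have kN : kap * N%:R = m%:R by rewrite /kap natrM mulrCA mulVf ?mulr1 ?gt_eqF.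
rewrite /flat_fun /phi flatmul_flat // mul0r addr0.
have quadE (a c : R) : kap * (a * (N%:R - a) + c * (N%:R - c))
   = (kap * N%:R) * (a + c) - kap * (a * a + c * c) by ring.
rewrite quadE kN -!pmulrn.
have AC : (#|sA :&: S|%:R : R) * #|sB :\: S|%:R <= beta * m%:R * m%:R.
  exact: ler_pM.
have q0 : 0 <= kap * (#|sA :&: S|%:R * #|sA :&: S|%:R
                      + #|sB :\: S|%:R * #|sB :\: S|%:R).
  by rewrite mulr_ge0 // addr_ge0 // mulr_ge0.
have mAC := ler_wpM2l (ler0n R m) (lerD Ale CR).
by rewrite expr2; lra.
Qed.

Definition cap : R := k%:R ^+ 2 * (1 + K%:R + 2 * kap).

Lemma planted_cap h S : planted_fun h S <= m%:R ^+ 2 * cap.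
Proof.
apply: le_trans (hard_ub _ _ K_gt0 eps_ge0 kap_ge0 cardA cardB _) _.
by rewrite /cap /N natrM exprMn mulrA.
Qed.

Lemma cap_ge0 : 0 <= cap.
Proof. by rewrite mulr_ge0 ?sqr_ge0 // !addr_ge0 // mulr_ge0. Qed.

Lemma query_tradeoff (d : measure_display) (Omega : measurableType d)
    (P : probability Omega R)
    (alg : Omega -> history R n -> action n) (q : nat) :
  (forall f : {set 'I_n} -> R, nonneg_fun f -> submodular f ->
     let out w := odflt (finset.set0 : {set 'I_n}) (run (alg w) f q [::]) in
     (forall T : {set 'I_n}, measurable [set w | out w = T]) /\
     (forall w, bicriteria_feasible (@part n K) (rank m K) beta (out w)) /\
     (forall O, is_opt (@part n K) (rank m K) f O ->
        ((alpha * f O)%:E <= \int[P]_w (f (out w))%:E)%E)) ->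
  alpha * K%:R / 4
  <= 2 * beta + 1 + 4 * cap * q.+1%:R * expR (- rate * m%:R).
Proof.
move=> algP.
pose out h w := odflt (finset.set0 : {set 'I_n})
  (run (alg w) (planted_fun h) q [::]).
have algh h := algP _ (@planted_fun_ge0 h) (@planted_fun_submodular h).
have m2 : (0 : R) < m%:R ^+ 2 by rewrite exprn_gt0 // ltr0n.
set e := expR _.
pose B : R := k%:R ^+ m * (m%:R ^+ 2 * (2 * beta + 1))
   + q.+1%:R * (4 * k%:R ^+ m * e) * (m%:R ^+ 2 * cap).
suff avg : \sum_(h : {ffun 'I_m -> 'I_k}) alpha * (K%:R * m%:R ^+ 2 / 4) <= B.
  have km : (0 : R) < k%:R ^+ m by rewrite exprn_gt0.
  have kmm := mulr_gt0 km m2.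
  rewrite -(ler_pM2l kmm); apply: le_trans (le_trans avg _).
    rewrite sumr_const card_ffun !card_ord -[leRHS]mulr_natr natrX.
    by rewrite le_eqVlt; apply/orP; left; apply/eqP; ring.
  by rewrite /B le_eqVlt; apply/orP; left; apply/eqP; ring.
apply: (@averaging _ _ _ P _ _ out planted_fun) => [h T|h T|h|w].
- by have [] := algh h.
- exact: planted_fun_ge0.
- have [_ [_ opt]] := algh h.
  have [Z Zopt Zge] := exists_opt (planted_fun h) (planted_base mn h).
  apply: le_trans _ (opt Z Zopt); rewrite lee_fin ler_wpM2l ?(ltW alpha_gt0) //.
  exact: le_trans (planted_value h) Zge.
pose T0 := odflt (finset.set0 : {set 'I_n}) (run (alg w) flat_fun q [::]).
pose Qs := T0 :: queries (alg w) flat_fun q [::].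
pose bad := [set h | has (unbalanced h) Qs].
have good h : h \notin bad -> planted_fun h (out h w) <= m%:R ^+ 2 * (2 * beta + 1).
  rewrite inE => /hasPn hQ.
  have agree : {in Qs, planted_fun h =1 flat_fun}.
    by move=> Q /hQ; exact: planted_flat.
  have oT : out h w = T0.
    rewrite /out /T0 (@run_agree _ _ _ _ flat_fun) // => Q QQ.
    by apply: agree; rewrite inE QQ orbT.
  rewrite oT agree ?mem_head // -oT; apply: flat_feasible.
  exact: (algh h).2.1.
have badle : #|bad|%:R <= q.+1%:R * (4 * k%:R ^+ m * e).
  apply: le_trans (card_has_le Qs unbalanced_rare) _.
  apply: ler_wpM2r; last by rewrite ler_nat ltnS size_queries.
  by rewrite mulr_ge0 ?expR_ge0 // mulr_ge0 // exprn_ge0.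
have bound_ge0 : 0 <= m%:R ^+ 2 * (2 * beta + 1).
  have feas := (algh [ffun=> ord0]).2.1 w.
  have [_ Ale] := feasible_card (@base_side _ _ _ mn false) feas.
  have b0 : 0 <= beta.
    rewrite muln1 in Ale; have m0 : (0 : R) < m%:R by rewrite ltr0n.
    by rewrite -(pmulr_lge0 _ m0); apply: le_trans Ale.
  by rewrite mulr_ge0 ?(ltW m2) // addr_ge0 // mulr_ge0.
rewrite (bigID (mem bad)) /= addrC; apply: lerD.
  apply: (@le_trans _ _ (\sum_(h | h \notin bad) m%:R ^+ 2 * (2 * beta + 1))).
    exact: ler_sum.
  rewrite sumr_const -[leLHS]mulr_natl ler_wpM2r //.
  rewrite -natrX ler_nat; apply: leq_trans (max_card _) _.
  by rewrite card_ffun !card_ord.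
apply: (@le_trans _ _ (\sum_(h in bad) m%:R ^+ 2 * cap)).
  by apply: ler_sum => h _; exact: planted_cap.
by rewrite sumr_const -[leLHS]mulr_natl ler_wpM2r // mulr_ge0 ?cap_ge0 ?(ltW m2).
Qed.

End Core.

Theorem theorem5p27 (R : realType) (alpha beta : R) :
  0 < alpha -> alpha <= 1 -> 1 <= beta ->
  exists c : R, 0 < c /\ exists n0 : nat, forall n : nat, (n0 <= n)%N ->
  forall (d : measure_display) (Omega : measurableType d)
         (P : probability Omega R)
         (alg : ('I_n -> nat) * (nat -> nat) -> Omega -> history R n -> action n)
         (q : nat),
  (forall (part : 'I_n -> nat) (r : nat -> nat) (f : {set 'I_n} -> R),
     valid_pm part r -> nonneg_fun f -> submodular f ->
     (* at most q queries on every seed *)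
     (forall w, isSome (run (alg (part, r) w) f q [::])) /\
     (let out := fun w => odflt (finset.set0 : {set 'I_n}) (run (alg (part, r) w) f q [::]) in
      (* the output is a random variable *)
      (forall T : {set 'I_n}, measurable [set w | out w = T]) /\
      (* every possible output is (1, beta)-bicriteria feasible *)
      (forall w, bicriteria_feasible part r beta (out w)) /\
      (* E[f(S)] >= alpha f(OPT) *)
      (forall O, is_opt part r f O ->
         ((alpha * f O)%:E <= \int[P]_w (f (out w))%:E)%E))) ->
  expR (c * n%:R) <= q%:R.
Proof.
move=> alpha0 _ beta1.
pose K := (Num.truncn (8 * (beta + 1) / alpha)).+1.
have K0 : (0 < K)%N by [].
have Kbig : 2 * beta + 2 <= alpha * K%:R / 4.
  have := truncnS_gt (8 * (beta + 1) / alpha); rewrite -/K.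
  by rewrite ltr_pdivrMr // => h; lra.
pose W : R := 4 * cap R K.
pose c : R := rate R K / (8 * K.+1%:R).
have k0 : (0 : R) < K.+1%:R by rewrite ltr0n.
have rate0 : 0 < rate R K.
  rewrite divr_gt0 // ?exprn_gt0 ?invr_gt0 ?ltr0n ?expn_gt0 //.
  by rewrite mulr_gt0 // exprn_gt0 // ltr0n muln_gt0.
have c0 : 0 < c by rewrite divr_gt0 // mulr_gt0.
have W0 : 0 < W.
  by rewrite /W /cap !pmulr_rgt0 ?exprn_gt0 //.
exists c; split=> //.
pose M := (2 ^ (K.+1 * K.+1).+1)%N.
exists (2 * K.+1 * M + (Num.truncn (2 * W / c)).+1)%N => n nbig d Omega P alg q algP.
pose m := (n %/ (2 * K.+1))%N.
have mn : (2 * m * K.+1 <= n)%N.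
  by rewrite mulnAC mulnC; exact: leq_trunc_div.
have mM : (M <= m)%N.
  by rewrite leq_divRL // mulnC; apply: leq_trans nbig; exact: leq_addr.
have nm : (n <= 4 * K.+1 * m)%N.
  have := ltn_ceil n (isT : (0 < 2 * K.+1)%N); rewrite -/m.
  have m0 : (0 < m)%N by apply: leq_trans mM; rewrite expn_gt0.
  by nia.
have tr := query_tradeoff mn K0 alpha0 mM (P := P) (alg := alg (@part n K, rank m K))
  (q := q).
have {}tr : alpha * K%:R / 4
  <= 2 * beta + 1 + W * q.+1%:R * expR (- rate R K * m%:R).
  by apply: tr => f f0 fs; have [] := algP _ _ f (pm_valid mn K0) f0 fs.
have one : 1 <= W * q.+1%:R * expR (- rate R K * m%:R) by lra.
set E := expR (c * n%:R).
have E0 : 0 < E := expR_gt0 _.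
have EW : 2 * W <= E.
  apply: le_trans (expR_ge1Dx _).
  have : (Num.truncn (2 * W / c)).+1%:R <= (n%:R : R).
    by rewrite ler_nat; apply: leq_trans nbig; exact: leq_addl.
  have := truncnS_gt (2 * W / c); rewrite ltr_pdivrMr // => h1 h2.
  have {}h2 := ler_wpM2r (ltW c0) h2.
  by rewrite [c * _]mulrC ler_wpDl //; exact: le_trans (ltW h1) h2.
have E1 : 1 <= E by rewrite -expR0 ler_expR mulr_ge0 // ltW.
have E2 : E ^+ 2 <= expR (rate R K * m%:R).
  rewrite expr2 -expRD ler_expR.
  have : (n%:R : R) <= 4 * K.+1%:R * m%:R by rewrite -!natrM ler_nat.
  move=> /(ler_wpM2l (ltW c0)).
  have -> : c * (4 * K.+1%:R * m%:R) = rate R K * m%:R / 2.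
    by rewrite /c; field; rewrite gt_eqF.
  lra.
have EWq : E ^+ 2 <= W * q.+1%:R.
  have e0 := expR_gt0 (rate R K * m%:R).
  apply: le_trans E2 _.
  have := ler_wpM2r (ltW e0) one.
  by rewrite mul1r -[leRHS]mulrA -expRD mulNr addNr expR0 mulr1.
have q2E : 2 * E <= q.+1%:R.
  rewrite -(ler_pM2l W0); apply: le_trans EWq.
  by rewrite expr2 mulrCA mulrA ler_wpM2r ?(ltW E0).
by move: q2E; rewrite -natr1; lra.
Qed.
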